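(* For all $r,s,t,k\in\mathbb{N}$ with $r\geq 2$ there is a constant $C=C(r,s,t,k)$ such that: if $H=(V_1,\dots,V_r;E)$ is a semilinear $r$-partite $r$-uniform hypergraph of description complexity $(s,t)$ which is $K_{k,\dots,k}$-free, then $$|E|\leq C\, n^{r-1}\log^{s(2^{r-1}-1)}(n),$$ where $n=|V_1|+\dots+|V_r|$.
   Context: All $V_i$ are finite. A set $X\subseteq\mathbb{R}^d$ is semilinear of description complexity $(s,t)$ if it is a union of at most $t$ sets of the form $\{x\in\mathbb{R}^d: f_1(x)\le 0,\dots,f_p(x)\le 0, f_{p+1}(x)<0,\dots,f_s(x)<0\}$ with $p\le s$ and each $f_i(x_1,\dots,x_d)=\lambda_1x_1+\dots+\lambda_dx_d+a$ an affine function with real coefficients. An $r$-partite $r$-uniform hypergraph $H=(V_1,\dots,V_r;E)$ (with $E\subseteq V_1\times\dots\times V_r$) is semilinear of description complexity $(s,t)$ if there are $d_i\in\mathbb{N}$, sets $V_i'\subseteq\mathbb{R}^{d_i}$ and a semilinear set $X\subseteq\prod_{i\in[r]}\mathbb{R}^{d_i}$ of description complexity $(s,t)$ such that $H$ is isomorphic to $(V_1',\dots,V_r';X\cap\prod_i V_i')$. $H$ is $K_{k,\dots,k}$-free if there are no $C_i\subseteq V_i$ with $|C_i|=k$ for all $i$ and $C_1\times\dots\times C_r\subseteq E$. *)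

(* Defs.v *)
From HB Require Import structures.
From mathcomp Require Import all_boot all_order all_algebra finmap.
From mathcomp Require Import boolp classical_sets reals exp.

Set Implicit Arguments.
Unset Strict Implicit.
Unset Printing Implicit Defensive.

Import Order.TTheory GRing.Theory Num.Theory.
Local Open Scope classical_set_scope.
Local Open Scope ring_scope.

Definition affine_fun (R : realType) (d : nat) (lam : 'rV[R]_d) (a : R)
    (x : 'rV[R]_d) : R :=
  \sum_(j < d) lam 0 j * x 0 j + a.

(* The indices i < p carry the weak inequalities, the indices p <= i < s the
   strict ones. *)
Definition basic_semilinear (R : realType) (d s : nat) (A : set 'rV[R]_d) :
    Prop :=
  exists (p : nat) (lam : 'I_s -> 'rV[R]_d) (a : 'I_s -> R),
    (p <= s)%N /\
    A = [set x | forall i : 'I_s,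
           if (i < p)%N then affine_fun (lam i) (a i) x <= 0
           else affine_fun (lam i) (a i) x < 0].

Definition semilinear_set (R : realType) (d s t : nat) (X : set 'rV[R]_d) :
    Prop :=
  exists (t' : nat) (B : 'I_t' -> set 'rV[R]_d),
    [/\ (t' <= t)%N, forall j, basic_semilinear s (B j)
      & X = \bigcup_(j in [set: 'I_t']) B j].

Record hypergraph (r : nat) := Hypergraph {
  part : 'I_r -> finType;
  edges : {set {dffun forall i : 'I_r, part i}}
}.

Definition hypergraph_iso (r : nat) (H H' : hypergraph r) : Prop :=
  exists f : forall i : 'I_r, part H i -> part H' i,
    (forall i, bijective (f i)) /\
    (forall e : {dffun forall i : 'I_r, part H i},
       e \in edges H <->
       ([ffun i => f i (e i)] : {dffun forall i : 'I_r, part H' i})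
         \in edges H').

(* (V_1, ..., V_r; X `&` \prod_i V_i), where \prod_i R^(d i) is identified with
   R^(\sum_i d i) by concatenating row vectors. *)
Definition induced_hypergraph (R : realType) (r : nat) (d : 'I_r -> nat)
    (V : forall i : 'I_r, {fset 'rV[R]_(d i)})
    (X : set 'rV[R]_(\sum_(i < r) d i)) : hypergraph r :=
  @Hypergraph r (fun i => V i : finType)
    [set e : {dffun forall i : 'I_r, V i} |
       `[< X (\mxrow_(i < r) val (e i)) >]]%SET.

Definition semilinear_hypergraph (R : realType) (r s t : nat)
    (H : hypergraph r) : Prop :=
  exists (d : 'I_r -> nat) (V : forall i : 'I_r, {fset 'rV[R]_(d i)})
         (X : set 'rV[R]_(\sum_(i < r) d i)),
    semilinear_set s t X /\ hypergraph_iso H (induced_hypergraph V X).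

Definition K_free (r k : nat) (H : hypergraph r) : Prop :=
  ~ exists C : forall i : 'I_r, {set part H i},
      (forall i, #|C i| = k) /\ setXn C \subset edges H.

Definition nvertices (r : nat) (H : hypergraph r) : nat :=
  (\sum_(i < r) #|part H i|)%N.

(* Main.v *)
Require Import Defs.
From mathcomp Require Import all_boot all_order all_algebra.
From mathcomp Require Import boolp reals exp.

Import Order.TTheory GRing.Theory Num.Theory.
Local Open Scope ring_scope.

Set Implicit Arguments.
Unset Strict Implicit.
Unset Printing Implicit Defensive.

(** By linearity each inequality reads h(x_2, ..., x_r) < g(x_1). Split V_1 along
    the median of g, for one inequality at a time: pairs on the same side of the
    median recurse on half of V_1, and on the remaining pairs the inequality holds
    throughout or nowhere. With n vertices and s inequalities this covers the
    edges by products A x B, where A is cut out of V_2 x ... x V_r by s lower and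
    s upper bounds on the functions h, at a cost of a factor log n per inequality.
    If |B| >= k then A is itself K_{k,...,k}-free, hence small by induction on r;
    if |B| < k then |A| |B| <= k |A|. *)

(** * Thresholds and medians of functions on finite sets *)

Section FiniteBounds.
Variables (R : realDomainType) (W : finType) (h : W -> R).

Lemma finite_ubound : exists b, forall w, h w < b.
Proof.
exists (1 + \sum_w `|h w|) => w; rewrite (bigD1 w) //= addrCA.
rewrite (le_lt_trans (ler_norm _)) // ltrDl ltr_pwDl // sumr_ge0 //.
Qed.

(** The threshold [a'] is the largest value of [h] below [a], or [a - 1] if there is none. *)
Lemma finite_le_lt (a : R) : exists a', forall w, (a <= h w) = (a' < h w).
Proof.
have [/existsP[w0 hw0]|/existsPn none] := boolP [exists w, h w < a]; last first.
  exists (a - 1) => w; have aw : a <= h w by rewrite leNgt none.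
  by rewrite aw (lt_le_trans _ aw) // ltrBlDr ltrDl.
have [w1 hw1 maxw1] := @arg_maxP _ _ W w0 (fun w => h w < a) h hw0.
exists (h w1) => w; apply/idP/idP; first exact: lt_le_trans.
by move=> w1w; rewrite leNgt; apply/negP => /maxw1; rewrite /= leNgt w1w.
Qed.

End FiniteBounds.

(** Greedy choice: [A] grows by a minimiser of [g] on the rest of [B]. Ties are broken arbitrarily,
    so every size [q] is reached even if [g] is not injective. *)
Lemma lower_subset (R : realDomainType) (Y : finType) (g : Y -> R)
    (B : {set Y}) (q : nat) :
  (q <= #|B|)%N ->
  exists2 A : {set Y}, A \subset B /\ #|A| = q
    & forall y z, y \in A -> z \in B :\: A -> g y <= g z.
Proof.
elim: q => [_|q IH qB].
  by exists set0 => [|y z]; rewrite ?sub0set ?cards0 // inE.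
have [A [AB cA] Ale] := IH (ltnW qB).
have /card_gt0P[z0 z0B] : (0 < #|B :\: A|)%N.
  by rewrite cardsD (setIidPr AB) cA subn_gt0.
have [z1 z1B minz1] := @arg_minP _ _ Y z0 (fun z => z \in B :\: A) g z0B.
have /setDP[z1inB z1A] := z1B.
exists (z1 |: A) => [|y z].
  by rewrite subUset sub1set z1inB AB cardsU1 z1A cA.
rewrite !inE negb_or -andbA => /orP[/eqP->|yA] /and3P[_ zA zB].
  by apply: minz1; rewrite !inE zA.
by apply: Ale => //; rewrite inE zA.
Qed.

Lemma median_split (R : realDomainType) (Y : finType) (g : Y -> R)
    (B : {set Y}) (q : nat) :
  (q < #|B|)%N ->
  exists2 A : {set Y}, A \subset B /\ #|A| = q
    & exists c, (forall y, y \in A -> g y <= c)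
             /\ (forall y, y \in B :\: A -> c <= g y).
Proof.
move=> qB; have [A [AB cA] Ale] := lower_subset g (ltnW qB).
exists A => //.
(* Since [q < #|B|], the rest of [B] is nonempty, and the minimum of [g] on it serves as [c]. *)
have /card_gt0P[z0 z0B] : (0 < #|B :\: A|)%N.
  by rewrite cardsD (setIidPr AB) cA subn_gt0.
have [z1 z1B minz1] := @arg_minP _ _ Y z0 (fun z => z \in B :\: A) g z0B.
by exists (g z1); split=> [y yA|y /minz1]; first exact: Ale.
Qed.

(** * Counting pairs that satisfy several inequalities, by divide and conquer *)

Section Dominance.
Variables (R : realDomainType) (W Y I : finType).
Variables (h : I -> W -> R) (g : I -> Y -> R).

Definition dominance_graph (J : {set I}) (A : {set W}) (B : {set Y}) :
    {set W * Y} :=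
  [set p | [&& p.1 \in A, p.2 \in B & [forall i in J, h i p.1 < g i p.2]]].

Lemma dominance_graphP (J : {set I}) (A : {set W}) (B : {set Y}) w y :
  reflect [/\ w \in A, y \in B & forall i, i \in J -> h i w < g i y]
    ((w, y) \in dominance_graph J A B).
Proof.
rewrite inE /=; apply: (iffP and3P) => -[wA yB Jwy]; split=> //.
  by move=> i iJ; apply: (implyP (forallP Jwy i)).
by apply/forall_inP.
Qed.

Lemma dominance_graph_sub (J : {set I}) (A : {set W}) (B : {set Y}) :
  dominance_graph J A B \subset setX A B.
Proof. by apply/subsetP=> -[w y] /dominance_graphP[wA yB _]; apply/setXP. Qed.

(** [F] is a class of sets stable under the threshold cuts of the recursion. The forbidden box
    enters only through [F_card], which concerns complete products. *)
Variables (F : {set W} -> Prop) (Y0 : {set Y}) (k M : nat).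
Hypothesis F_lt : forall (A : {set W}) i c, F A -> F [set w in A | h i w < c].
Hypothesis F_ge : forall (A : {set W}) i c, F A -> F [set w in A | c <= h i w].
Hypothesis k_gt0 : (0 < k)%N.
Hypothesis F_card : forall (A : {set W}) (B : {set Y}), F A -> B \subset Y0 ->
  (k <= #|B|)%N -> setX A B \subset dominance_graph setT A B -> (#|A| <= M)%N.

(* Halving B along one inequality leaves two subproblems on disjoint parts of A
   and of B, and one subproblem in which that inequality holds throughout. *)
Lemma card_dominance_graph (l : nat) (J : {set I}) (A : {set W}) (B : {set Y}) :
  F A -> B \subset Y0 -> (#|B| <= 2 ^ l)%N ->
  setX A B \subset dominance_graph (~: J) A B ->
  (#|dominance_graph J A B| <= (k * #|A| + M * #|B|) * l.+1 ^ #|J|)%N.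
Proof.
move cJ: #|J| => n; elim: n J cJ A B => [|n IHn] J cJ A B FA BY0 cB full.
  (* No inequality is left, so the product is complete: either [F_card] gives [#|A| <= M], or
     [#|B| < k]. *)
  have J0 := cards0_eq cJ; rewrite J0 setC0 in full.
  rewrite expn0 muln1 (leq_trans (subset_leq_card (dominance_graph_sub _ _ _))) //.
  rewrite cardsX; have [kB|Bk] := leqP k #|B|.
    by rewrite (leq_trans (leq_mul (F_card FA BY0 kB full) (leqnn _))) ?leq_addl.
  by rewrite mulnC (leq_trans (leq_mul (ltnW Bk) (leqnn _))) ?leq_addr.
have /card_gt0P[i iJ] : (0 < #|J|)%N by rewrite cJ.
have cJi : #|J :\ i| = n by move: cJ; rewrite (cardsD1 i) iJ => -[].
(* Inner induction on the size of [B]. Here [l] stays fixed, so the outer induction hypothesis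
   always contributes the same factor [l.+1 ^ n]. *)
suff halve m : (m <= l)%N -> forall (A : {set W}) (B : {set Y}), F A ->
    B \subset Y0 -> (#|B| <= 2 ^ m)%N ->
    setX A B \subset dominance_graph (~: J) A B ->
    (#|dominance_graph J A B| <= (k * #|A| + M * #|B|) * (m.+1 * l.+1 ^ n))%N.
  by rewrite expnS; apply: halve.
elim: m => [|m IHm] ml {FA BY0 cB full} {}A {}B FA BY0 cB full.
  (* Now [#|B| <= 1], so there are at most [#|A|] pairs. *)
  rewrite (leq_trans (subset_leq_card (dominance_graph_sub _ _ _))) // cardsX.
  rewrite mul1n (@leq_trans (k * #|A|)) //.
    by rewrite mulnC leq_mul // (leq_trans cB).
  by rewrite (leq_trans (leq_addr (M * #|B|) _)) // leq_pmulr // expn_gt0.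
have [sB|gB] := leqP #|B| (2 ^ m).
  rewrite (leq_trans (IHm (ltnW ml) _ _ FA BY0 sB full)) //.
  by rewrite leq_mul2l leq_mul2r leqnSn !orbT.
(* [Bl] gets exactly [2 ^ m] elements, which leaves at most [2 ^ m] for [Bh]. *)
have [Bl [BlB cBl] [c [Blc cBh]]] := median_split (g i) gB.
set Bh := B :\: Bl in cBh.
have BhB : Bh \subset B by apply: subsetDl.
have cBD : (#|Bl| + #|Bh| = #|B|)%N by rewrite -(cardsID Bl B) (setIidPr BlB).
have cBh2 : (#|Bh| <= 2 ^ m)%N.
  by move: cB; rewrite -cBD cBl expnS mul2n -addnn leq_add2l.
pose Al := [set w in A | h i w < c]; pose Ah := [set w in A | c <= h i w].
have cAD : (#|Al| + #|Ah| = #|A|)%N.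
  rewrite -(cardsID [set w | h i w < c] A); congr (_ + _)%N; apply: eq_card => w.
    by rewrite !inE.
  by rewrite !inE -leNgt andbC.
have AlA : Al \subset A by apply/subsetP=> w; rewrite inE => /andP[].
have AhA : Ah \subset A by apply/subsetP=> w; rewrite inE => /andP[].
have sub_full (A' : {set W}) (B' : {set Y}) : A' \subset A -> B' \subset B ->
    setX A' B' \subset dominance_graph (~: J) A' B'.
  move=> /subsetP sA /subsetP sB; apply/subsetP => -[w y] /setXP[wA yB].
  apply/dominance_graphP; split=> //.
  have : (w, y) \in setX A B by apply/setXP; split; [apply: sA|apply: sB].
  by move/(subsetP full)/dominance_graphP => [].
(* On [Ah] times [Bl] inequality [i] fails, as [g i y <= c <= h i w]. On [Al] times [Bh] it always
   holds, as [h i w < c <= g i y], so [i] leaves [J] there. *)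
have Gsub : dominance_graph J A B \subset
    dominance_graph J Al Bl :|: dominance_graph J Ah Bh
    :|: dominance_graph (J :\ i) Al Bh.
  apply/subsetP => -[w y] /dominance_graphP[wA yB Jwy].
  have hg := Jwy i iJ.
  have Jwy' j : j \in J :\ i -> h j w < g j y by case/setD1P => _ /Jwy.
  rewrite !in_setU; have [wc|cw] := ltP (h i w) c; last first.
    apply/orP; left; apply/orP; right; apply/dominance_graphP; split=> //.
      by rewrite inE wA.
    rewrite inE yB andbT; apply/negP => /Blc yc.
    by move: hg; rewrite ltNge (le_trans yc cw).
  have wAl : w \in Al by rewrite inE wA.
  have [yBl|yBl] := boolP (y \in Bl).
    by apply/orP; left; apply/orP; left; apply/dominance_graphP.
  by apply/orP; right; apply/dominance_graphP; split=> //; rewrite inE yBl.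
rewrite (leq_trans (subset_leq_card Gsub)) //.
rewrite (leq_trans (leq_card_setU _ _)) //.
rewrite (leq_trans (leq_add (leq_card_setU _ _) (leqnn _))) //.
have b1 := IHm (ltnW ml) Al Bl (F_lt _ _ FA) (subset_trans BlB BY0)
  (eq_leq cBl) (sub_full _ _ AlA BlB).
have b2 := IHm (ltnW ml) Ah Bh (F_ge _ _ FA) (subset_trans BhB BY0)
  cBh2 (sub_full _ _ AhA BhB).
have b3 : (#|dominance_graph (J :\ i) Al Bh| <=
    (k * #|A| + M * #|B|) * l.+1 ^ n)%N.
  apply: (leq_trans (IHn _ cJi Al Bh (F_lt _ _ FA) (subset_trans BhB BY0) _ _)).
  - by rewrite (leq_trans cBh2) // leq_exp2l // ltnW.
  - apply/subsetP => -[w y] wy; have /setXP[wA yB] := wy.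
    have /dominance_graphP[_ _ Jwy] := subsetP (sub_full _ _ AlA BhB) _ wy.
    apply/dominance_graphP; split=> // j.
    rewrite !inE negb_and negbK => /orP[/eqP->|jJ].
      by apply: lt_le_trans (cBh y yB); move: wA; rewrite inE => /andP[].
    by apply: Jwy; rewrite inE.
  - by rewrite leq_mul2r leq_add ?orbT // leq_mul2l subset_leq_card ?orbT.
(* The two halves partition [A] and [B], so together they cost the factor [m.+1]; the mixed product
   adds one more. *)
apply: leq_trans (leq_add (leq_add b1 b2) b3) _.
by rewrite -mulnDl addnACA -!mulnDr cAD cBD -mulnDr -mulSnr.
Qed.

End Dominance.

(** * Box-free sets cut out by sums of one-variable functions *)

Definition separable_edges (R : realDomainType) (T I : finType) (r : nat)
    (D : 'I_r -> {set T}) (f : I -> 'I_r -> T -> R) (c : I -> R) :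
    {set {ffun 'I_r -> T}} :=
  [set x : {ffun 'I_r -> T} | [forall j, x j \in D j]
     && [forall i, \sum_(j < r) f i j (x j) < c i]].

(** Sides may be larger than [k], so a large [B] can serve as a side without being shrunk. *)
Definition box_free (T : finType) (r k : nat) (E : {set {ffun 'I_r -> T}}) :
    Prop :=
  forall C : 'I_r -> {set T}, (forall j, (k <= #|C j|)%N) ->
  ~ (forall x : {ffun 'I_r -> T}, (forall j, x j \in C j) -> x \in E).

Lemma separable_edgesP (R : realDomainType) (T I : finType) (r : nat)
    (D : 'I_r -> {set T}) (f : I -> 'I_r -> T -> R) (c : I -> R)
    (x : {ffun 'I_r -> T}) :
  reflect ((forall j, x j \in D j) /\ (forall i, \sum_(j < r) f i j (x j) < c i))
    (x \in separable_edges D f c).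
Proof.
by rewrite inE; apply: (iffP andP) => -[xD xf]; split; apply/forallP.
Qed.

Section Slab.
Variables (R : realDomainType) (W I : finType) (h : I -> W -> R) (W0 : {set W}).

(** This class instantiates [F]. With strict bounds on both sides a slab is again separable: a lower
    bound on [h i] is an upper bound on [- h i]. *)
Definition slab (A : {set W}) : Prop :=
  exists a b : I -> R,
    A = [set w in W0 | [forall i, (a i < h i w) && (h i w < b i)]].

Lemma slab_lt A i c : slab A -> slab [set w in A | h i w < c].
Proof.
move=> [a [b ->]]; exists a, [eta b with i |-> Num.min (b i) c].
apply/setP => w; rewrite !inE -andbA; congr (_ && _).
apply/andP/forallP => [[/forallP ab wc] j|ab] /=.
  by case: eqP => [->|_]; rewrite ?lt_min ?wc ?andbT; apply: ab.
split; last by have /= := ab i; rewrite eqxx lt_min => /and3P[].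
apply/forallP => j; have /= := ab j; case: eqP => // ->.
by rewrite lt_min => /and3P[-> ->].
Qed.

Lemma slab_ge A i c : slab A -> slab [set w in A | c <= h i w].
Proof.
(* Lower bounds of a slab are strict, so the weak cut at [c] is replaced by a strict one at [c']. *)
move=> [a [b ->]]; have [c' cc'] := finite_le_lt (h i) c.
exists [eta a with i |-> Num.max (a i) c'], b.
apply/setP => w; rewrite !inE -andbA; congr (_ && _); rewrite cc'.
apply/andP/forallP => [[/forallP ab wc] j|ab] /=.
  by case: eqP => [->|_]; rewrite ?gt_max ?wc ?andbT; apply: ab.
split; last by have /= := ab i; rewrite eqxx gt_max => /andP[/andP[]].
apply/forallP => j; have /= := ab j; case: eqP => // ->.
by rewrite gt_max => /andP[/andP[-> _] ->].
Qed.

Lemma slab_total : slab W0.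
Proof.
have [M hM] := finite_ubound (fun p : I * W => `|h p.1 p.2|).
exists (fun=> - M), (fun=> M); apply/setP => w; rewrite inE.
rewrite (_ : [forall i, _] = true) ?andbT //; apply/forallP => i.
by rewrite -ltr_norml; apply: (hM (i, w)).
Qed.

End Slab.

Section FfunCons.
Variables (T : finType) (m : nat).

Definition ffun_cons (y : T) (w : {ffun 'I_m -> T}) : {ffun 'I_m.+1 -> T} :=
  [ffun j => if unlift ord0 j is Some j' then w j' else y].

Definition ffun_behead (x : {ffun 'I_m.+1 -> T}) : {ffun 'I_m -> T} :=
  [ffun j => x (lift ord0 j)].

Lemma ffun_cons0 y w : ffun_cons y w ord0 = y.
Proof. by rewrite ffunE unlift_none. Qed.

Lemma ffun_consS y w j : ffun_cons y w (lift ord0 j) = w j.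
Proof. by rewrite ffunE liftK. Qed.

Lemma ffun_head_behead_inj :
  injective (fun x : {ffun 'I_m.+1 -> T} => (ffun_behead x, x ord0)).
Proof.
move=> x x' [/ffunP e e0]; apply/ffunP => j.
by case: (unliftP ord0 j) => [j'|] -> //; have := e j'; rewrite !ffunE.
Qed.

End FfunCons.

(* A slab in the remaining coordinates is cut out by twice as many inequalities,
   so the exponent b(m, s) obeys b(m + 1, s) = s + b(m, 2 s), b(0, s) = 0. *)
Theorem card_box_free_separable_edges (R : realDomainType) (T : finType)
    (k m : nat) (I : finType) (D : 'I_m.+1 -> {set T})
    (f : I -> 'I_m.+1 -> T -> R) (c : I -> R) :
  (0 < k)%N -> box_free k (separable_edges D f c) ->
  (#|separable_edges D f c| <=
     k * m.+1 * #|T| ^ m * (up_log 2 #|T|).+1 ^ (#|I| * (2 ^ m - 1)))%N.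
Proof.
move=> k_gt0; elim: m I D f c => [|m IH] I D f c Efree.
  (* With one coordinate the edge set is itself a box, so it cannot have more than [k] elements. *)
  rewrite subnn muln0 !expn0 !muln1 leqNgt; apply/negP => kE.
  pose u (y : T) : {ffun 'I_1 -> T} := [ffun=> y].
  pose v (x : {ffun 'I_1 -> T}) := x ord0.
  have vu x : u (v x) = x by apply/ffunP => j; rewrite ffunE (ord1 j).
  have cE : #|u @^-1: separable_edges D f c| = #|separable_edges D f c|.
    apply: on_card_preimset; exists v => x _; [by rewrite /v ffunE|exact: vu].
  apply: (Efree (fun=> u @^-1: separable_edges D f c)) => [_|x xC].
    by rewrite cE ltnW.
  by rewrite -(vu x); have := xC ord0; rewrite inE.
(* The first coordinate is moved to the right-hand side: each inequality becomes [h i w < g i y]. *)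
pose h i (w : {ffun 'I_m.+1 -> T}) := \sum_(j < m.+1) f i (lift ord0 j) (w j).
pose g i y := c i - f i ord0 y.
pose W0 := [set w : {ffun 'I_m.+1 -> T} | [forall j, w j \in D (lift ord0 j)]].
pose l := up_log 2 #|T|.
pose M := (k * m.+1 * #|T| ^ m * l.+1 ^ ((#|I| + #|I|) * (2 ^ m - 1)))%N.
have consE y w : w \in W0 -> y \in D ord0 -> (forall i, h i w < g i y) ->
    ffun_cons y w \in separable_edges D f c.
  rewrite inE => /forallP wD yD hg; apply/separable_edgesP; split=> [j|i].
    by case: (unliftP ord0 j) => [j'|] ->; rewrite ?ffun_consS ?ffun_cons0.
  rewrite big_ord_recl ffun_cons0 addrC -ltrBrDr.
  by under eq_bigr => j _ do rewrite ffun_consS; apply: hg.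
(* If [A] times [B] is complete, a box inside [A] extends by the side [B] to a box of edges. Hence
   [A] is box-free and the induction hypothesis applies, with the index type [I + I] for upper and
   lower bounds. *)
have slab_card (A : {set {ffun 'I_m.+1 -> T}}) (B : {set T}) : slab h W0 A ->
    B \subset D ord0 -> (k <= #|B|)%N ->
    setX A B \subset dominance_graph h g setT A B -> (#|A| <= M)%N.
  move=> [a [b AE]] BD kB full.
  pose f' (i : I + I) j := match i with
    | inl i => f i (lift ord0 j) | inr i => fun y => - f i (lift ord0 j) y end.
  pose c' i := match i with inl i => b i | inr i => - a i end.
  have AE' : A = separable_edges (fun j => D (lift ord0 j)) f' c'.
    apply/setP => w; rewrite AE !inE; congr (_ && _).
    apply/forallP/forallP => [ab [i|i]|ab i] /=.
    - by have /andP[] := ab i.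
    - by rewrite sumrN ltrN2; have /andP[] := ab i.
    - have := ab (inl i); have := ab (inr i).
      by rewrite /= sumrN ltrN2 /h => -> ->.
  rewrite AE' /M -card_sum; apply: IH => C kC subC.
  pose C' j := if unlift ord0 j is Some j' then C j' else B.
  apply: (Efree C') => [j|x xC].
    by rewrite /C'; case: unliftP.
  have xA : ffun_behead x \in A.
    rewrite AE'; apply: subC => j; have := xC (lift ord0 j).
    by rewrite /C' liftK ffunE.
  have xB : x ord0 \in B by have := xC ord0; rewrite /C' unlift_none.
  have -> : x = ffun_cons (x ord0) (ffun_behead x).
    apply: ffun_head_behead_inj; congr (_, _); last by rewrite ffun_cons0.
    by apply/ffunP => j; rewrite [RHS]ffunE ffun_consS.
  have /(subsetP full)/dominance_graphP[_ _ hg] :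
      (ffun_behead x, x ord0) \in setX A B.
    exact/setXP.
  apply: consE => [||i]; last exact: hg.
    by move: xA; rewrite AE inE => /andP[].
  exact: (subsetP BD).
have cW : (#|W0| <= #|T| ^ m.+1)%N.
  by rewrite (leq_trans (max_card _)) // card_ffun card_ord.
have Esub : [set (ffun_behead x, x ord0) | x in separable_edges D f c] \subset
    dominance_graph h g setT W0 (D ord0).
  apply/subsetP => _ /imsetP[x /separable_edgesP[xD xf] ->].
  apply/dominance_graphP; split=> // [|i _].
    by rewrite inE; apply/forallP => j; rewrite ffunE.
  rewrite /h /g ltrBrDr addrC; have := xf i; rewrite big_ord_recl.
  by under [X in _ -> _ + X < _]eq_bigr => j _ do rewrite ffunE.
have := subset_leq_card Esub; rewrite card_imset; last exact: ffun_head_behead_inj.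
move=> /leq_trans; apply.
have cD : (#|D ord0| <= 2 ^ l)%N by rewrite (leq_trans (max_card _)) // up_logP.
apply: leq_trans (card_dominance_graph (@slab_lt _ _ _ h W0)
  (@slab_ge _ _ _ h W0) k_gt0 slab_card (slab_total h W0) (subxx _) cD _) _.
  by apply/subsetP => -[w y] /setXP[wA yB]; apply/dominance_graphP;
    split=> // i; rewrite !inE.
rewrite cardsT -/l.
(* The exponent splits into [2 * #|I| * (2 ^ m - 1)] from [M] and [#|I|] from the halving. *)
have e1 : (2 ^ m.+1 - 1 = (2 ^ m - 1) + (2 ^ m - 1) + 1)%N.
  by rewrite expnS mul2n -addnn -addnBA ?expn_gt0 // addnAC subnK ?expn_gt0.
have -> : (k * m.+2 * #|T| ^ m.+1 * l.+1 ^ (#|I| * (2 ^ m.+1 - 1)) =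
    k * m.+2 * #|T| ^ m.+1 * l.+1 ^ ((#|I| + #|I|) * (2 ^ m - 1))
      * l.+1 ^ #|I|)%N.
  by rewrite e1 mulnDr muln1 mulnDr -mulnDl expnD !mulnA.
rewrite leq_mul2r; apply/orP; right.
set L := (l.+1 ^ _)%N; have L_gt0 : (0 < L)%N by rewrite expn_gt0.
(* Of the factor [m.+2], the share [m.+1] pays for [M * #|D ord0|] and the remaining 1 for
   [k * #|W0|]. *)
rewrite -(addn1 m.+1) [(k * (_ + 1))%N]mulnDr muln1 !mulnDl addnC leq_add //.
  rewrite /M -/L [(#|T| ^ m.+1)%N]expnSr.
  rewrite -!mulnA leq_mul2l leq_mul2l leq_mul2l; apply/orP; right; apply/orP; right.
  by apply/orP; right; rewrite mulnC leq_mul2r max_card orbT.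
by rewrite (@leq_trans (k * #|T| ^ m.+1)) ?leq_mul2l ?cW ?orbT // leq_pmulr.
Qed.

(** * Transfer to hypergraphs with separate parts *)

Lemma subset_of_card (T : finType) (A : {set T}) (k : nat) :
  (k <= #|A|)%N -> exists2 B : {set T}, B \subset A & #|B| = k.
Proof.
rewrite -bin_gt0 -cards_draws => /card_gt0P[B]; rewrite inE => /andP[BA /eqP cB].
by exists B.
Qed.

(* Working in the disjoint union of the parts makes the edges non-dependent
   finite functions. *)
Lemma card_separable_subgraph (R : realDomainType) (m k : nat)
    (H : hypergraph m.+1) (I : finType)
    (phi : I -> forall j : 'I_m.+1, part H j -> R) (c : I -> R)
    (E : {set {dffun forall j : 'I_m.+1, part H j}}) :
  (0 < k)%N -> K_free k H -> E \subset edges H ->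
  (forall e : {dffun forall j : 'I_m.+1, part H j},
     e \in E <-> forall i, \sum_(j < m.+1) phi i j (e j) < c i) ->
  (#|E| <= k * m.+1 * nvertices H ^ m *
     (up_log 2 (nvertices H)).+1 ^ (#|I| * (2 ^ m - 1)))%N.
Proof.
move=> k_gt0 Hfree EH EP.
pose T : finType := {j : 'I_m.+1 & part H j}.
pose F (e : {dffun forall j : 'I_m.+1, part H j}) : {ffun 'I_m.+1 -> T} :=
  [ffun j => Tagged (fun j => part H j : Type) (e j)].
pose f i (j : 'I_m.+1) (u : T) := phi i (tag u) (tagged u).
pose D j := [set u : T | tag u == j].
have cT : #|T| = nvertices H.
  by rewrite card_tagged sumnE big_map big_enum.
have F_inj : injective F.
  move=> e e' /ffunP eF; apply/ffunP => j; have := eF j; rewrite !ffunE.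
  by move/eqP; rewrite eq_Tagged => /eqP.
have FE e : (F e \in separable_edges D f c) = (e \in E).
  apply/separable_edgesP/idP => [[_ ef]|/EP eE].
    apply/EP => i; apply: le_lt_trans (ef i); rewrite le_eqVlt; apply/orP; left.
    by apply/eqP/eq_bigr => j _; rewrite ffunE.
  split=> [j|i]; first by rewrite !inE ffunE.
  by under eq_bigr => j _ do rewrite ffunE; apply: eE.
rewrite -(card_imset _ F_inj) -cT.
apply: (@leq_trans #|separable_edges D f c|).
  apply: subset_leq_card; apply/subsetP => _ /imsetP[e eE ->].
  by rewrite FE.
apply: card_box_free_separable_edges => // C kC subC; apply: Hfree.
have /fin_all_exists[z zC] : forall j, exists u, u \in C j.
  by move=> j; apply/card_gt0P; apply: leq_trans (kC j).
(* All sides are nonempty because [0 < k], so each [u] in [C j] is a coordinate of some edge of the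
   box and lies in part [j]. *)
have CD j u : u \in C j -> tag u = j.
  move=> uC; pose x := [ffun j' => if j' == j then u else z j'].
  have /subC/separable_edgesP[xD _] : forall j', x j' \in C j'.
    by move=> j'; rewrite ffunE; case: eqP => [->|].
  by apply/eqP; have := xD j; rewrite inE ffunE eqxx.
pose C' j := [set v : part H j | Tagged (fun j => part H j : Type) v \in C j].
have kC' j : (k <= #|C' j|)%N.
  apply: leq_trans (kC j) _.
  apply: leq_trans (leq_imset_card (Tagged (fun j => part H j : Type)) _).
  apply: subset_leq_card; apply/subsetP => -[j' v] uC.
  have /= jj' := CD _ _ uC; subst j'; apply/imsetP; exists v => //.
  by rewrite inE.
(* [K_free] speaks of sides of size exactly [k], so the sides are shrunk. *)
have /fin_all_exists2[C'' C''C' cC''] := fun j => subset_of_card (kC' j).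
exists C''; split=> //; apply/subsetP => e /setXnP eC.
apply: (subsetP EH); rewrite -FE; apply: subC => j; rewrite ffunE.
by have := subsetP (C''C' j) _ (eC j); rewrite inE.
Qed.

(** * Affine inequalities, logarithms and the semilinear bound *)

Lemma affine_fun_mxrow (R : realType) (r : nat) (d : 'I_r -> nat)
    (lam : 'rV[R]_(\sum_(i < r) d i)) (a : R) (x : forall i, 'rV[R]_(d i)) :
  affine_fun lam a (\mxrow_(i < r) x i) =
  \sum_(i < r) (x i *m (submxrow lam i)^T) 0 0 + a.
Proof.
rewrite /affine_fun; congr (_ + a).
transitivity ((\mxrow_(i < r) x i *m lam^T) 0 0).
  by rewrite mxE; apply: eq_bigr => j _; rewrite [lam^T _ _]mxE mulrC.
by rewrite -{1}[lam]submxrowK tr_mxrow mul_mxrow_mxcol summxE.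
Qed.

(** For [u = up_log 2 n] one has [2 ^ (u - 1) < n], so [(u - 1) * ln 2 <= ln n]. The remaining 2 in
    [u + 1] costs at most [2 * ln n / ln 2], since [2 <= n]. *)
Lemma up_log_le_ln (R : realType) (n : nat) : (2 <= n)%N ->
  ((up_log 2 n).+1)%:R <= 3 / ln 2 * ln (n%:R : R).
Proof.
move=> n2; have ln2 : 0 < ln (2 : R) by rewrite ln_gt0 // ltr1n.
have lnn : ln 2 <= ln (n%:R : R) by rewrite ler_ln ?posrE ?ler_nat ?ltr0n // ltnW.
rewrite mulrAC ler_pdivlMr //.
have : ln (2 : R) *+ (up_log 2 n).-1 <= ln (n%:R : R).
  rewrite -lnXn // -natrX ler_ln ?posrE ?ltr0n ?expn_gt0 //; last exact: ltnW.
  by rewrite ler_nat ltnW // up_log_gtn.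
have -> : (up_log 2 n).+1 = (2 + (up_log 2 n).-1)%N.
  by rewrite -[in LHS](@prednK (up_log 2 n)) ?up_log_gt0.
rewrite natrD mulrDl -[ln 2 *+ _]mulr_natl => lnu.
rewrite -[3]/((2 + 1)%N%:R) natrD [X in _ <= X]mulrDl lerD ?mul1r //.
by rewrite ler_wpM2l.
Qed.

(* On a finite set a weak inequality is a strict one with a larger bound. *)
Lemma basic_semilinear_separable (R : realType) (r s : nat) (d : 'I_r -> nat)
    (P : 'I_r -> finType) (v : forall i, P i -> 'rV[R]_(d i))
    (B : classical_sets.set 'rV[R]_(\sum_(i < r) d i)) :
  basic_semilinear s B ->
  exists (phi : 'I_s -> forall i, P i -> R) (c : 'I_s -> R),
    forall e : {dffun forall i, P i},
      B (\mxrow_(i < r) v i (e i)) <->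
      forall l, \sum_(i < r) phi l i (e i) < c l.
Proof.
move=> [p [lam [a [_ ->]]]].
pose phi l i (x : P i) := (v i x *m (submxrow (lam l) i)^T) 0 0.
pose A l (e : {dffun forall i, P i}) :=
  affine_fun (lam l) (a l) (\mxrow_(i < r) v i (e i)).
have AE l e : A l e = \sum_(i < r) phi l i (e i) + a l.
  exact: affine_fun_mxrow.
suff /fin_all_exists[c cP] : forall l : 'I_s, exists c,
    forall e : {dffun forall i, P i},
    (if (l < p)%N then A l e <= 0 else A l e < 0) =
    (\sum_(i < r) phi l i (e i) < c).
  exists phi, c => e; split=> Be l; have := Be l; have := cP l e;
    by case: (l < p)%N => <-.
move=> l; case: (l < p)%N; last first.
  by exists (- a l) => e; rewrite AE -ltrBrDr sub0r.
have [b bP] := finite_le_lt (fun e => - A l e) 0.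
by exists (- b - a l) => e; rewrite -oppr_ge0 bP AE ltrBrDr ltrNr.
Qed.

Theorem mainTheorem3 (R : realType) (r s t k : nat) (hr : (2 <= r)%N) :
  exists C : R, forall H : hypergraph r,
    semilinear_hypergraph R s t H -> K_free k H ->
    #|edges H|%:R <=
      C * (nvertices H)%:R ^+ (r - 1)
        * ln ((nvertices H)%:R : R) ^+ (s * (2 ^ (r - 1) - 1)).
Proof.
case: r hr => // m hr; rewrite subn1 /=.
pose K : R := 3 / ln 2; pose x := (s * (2 ^ m - 1))%N.
have K_ge0 : 0 <= K by rewrite divr_ge0 ?ler0n // ln_ge0 // ler1n.
(* The factors come from the [t] basic pieces, the bound for one piece, and the passage from
   [up_log] to [ln]. *)
exists ((t * (k * m.+1))%:R * K ^+ x) => H.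
move=> [d [V [X [[t' [B [t't Bs XE]]]]]]] [f [f_bij fE]] Hfree.
(* An edge requires a vertex in each of at least two parts, so there are none here; the right-hand
   side is nonnegative because [ln 1] and, by convention, [ln 0] vanish. *)
have [n2|n2] := ltnP (nvertices H) 2.
  have -> : #|edges H| = 0%N.
    apply/eqP; rewrite cards_eq0; apply/set0Pn => -[e _].
    move: n2; rewrite ltnNge => /negP; apply; apply: leq_trans hr _.
    rewrite -[leqLHS]card_ord -sum1_card; apply: leq_sum => i _.
    by apply/card_gt0P; exists (e i).
  rewrite !mulr_ge0 ?exprn_ge0 ?ler0n //.
  by case: (nvertices H) n2 => [|[|]] // _; rewrite ?ln1 // ln0.
(* For [k = 0] the empty box lies in every edge set, contradicting [K_free]. *)
have k_gt0 : (0 < k)%N.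
  rewrite lt0n; apply/eqP => k0; apply: Hfree; exists (fun=> set0).
  split=> [i|]; first by rewrite cards0 k0.
  by apply/subsetP => e /setXnP /(_ ord0); rewrite inE.
pose v i (y : part H i) : 'rV[R]_(d i) := finmap.fsval (f i y).
pose E j := [set e : {dffun forall i, part H i} | `[< B j (\mxrow_i v i (e i)) >]].
have edgesP e : e \in edges H <-> X (\mxrow_i v i (e i)).
  rewrite fE inE; split=> [/asboolP|]; last move=> XH; last apply/asboolP.
    by congr X; apply/eq_mxrowP => i; rewrite ffunE.
  by move: XH; congr X; apply/eq_mxrowP => i; rewrite ffunE.
have EH j : E j \subset edges H.
  apply/subsetP => e; rewrite inE => /asboolP Bj; apply/edgesP.
  by rewrite XE; exists j.
have cE j : (#|E j| <= k * m.+1 * nvertices H ^ m *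
     (up_log 2 (nvertices H)).+1 ^ x)%N.
  have [phi [c phiP]] := basic_semilinear_separable v (Bs j).
  rewrite /x -[in (s * _)%N](card_ord s).
  apply: (card_separable_subgraph (phi := phi) (c := c)) => // e.
  by rewrite -phiP inE; split=> /asboolP.
have cH : (#|edges H| <= t * (k * m.+1) * nvertices H ^ m *
     (up_log 2 (nvertices H)).+1 ^ x)%N.
  (* The basic pieces cover the edges, and a union bound over at most [t] of them suffices. *)
  apply: (@leq_trans #|\bigcup_j E j|).
    apply: subset_leq_card; apply/subsetP => e /edgesP; rewrite XE => -[j _ Bj].
    by apply/bigcupP; exists j => //; rewrite inE; apply/asboolP.
  apply: (@leq_trans (\sum_j #|E j|)).
    elim/big_rec2: _ => [|j A N _ IH]; first by rewrite cards0.
    by rewrite (leq_trans (leq_card_setU _ _)) ?leq_add2l.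
  apply: leq_trans (leq_sum _ (fun j _ => cE j)) _.
  by rewrite sum_nat_const card_ord -!mulnA leq_mul2r t't orbT.
apply: (@le_trans _ _ (t * (k * m.+1) * nvertices H ^ m *
     (up_log 2 (nvertices H)).+1 ^ x)%N%:R); first by rewrite ler_nat.
rewrite natrM natrM !natrX -!mulrA ler_wpM2l ?ler0n // mulrCA.
rewrite ler_wpM2l ?exprn_ge0 ?ler0n //.
have lnn : 0 <= ln ((nvertices H)%:R : R) by rewrite ln_ge0 // ler1n ltnW.
rewrite -exprMn; apply: lerXn2r; rewrite ?nnegrE ?ler0n ?(mulr_ge0 K_ge0 lnn) //.
exact: up_log_le_ln.
Qed.
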